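(* Consider $n$ parties partitioned into $\mathrm A_1,\dots,\mathrm A_{n_{\mathsf Z}}$ and $\mathrm C_1,\dots,\mathrm C_{n_{\mathsf C}}$ with $n_{\mathsf Z}+n_{\mathsf C}=n$ and $n_{\mathsf C}>0$, with spaces $\mathcal{A}_1,\dots,\mathcal{A}_{n_{\mathsf Z}},\mathcal{C}_1,\dots,\mathcal{C}_{n_{\mathsf C}}$, and assume that the subspaces $\mathsf{C}_{\mathcal{C}_1},\dots,\mathsf{C}_{\mathcal{C}_{n_{\mathsf C}}}$ are all nonzero. Then any deterministic nonsignaling behavior of these parties has nonzero support (i.e. a nonzero component) in the subspace $$\mathsf{Z}_{\mathcal{A}_1}\otimes\dots\otimes\mathsf{Z}_{\mathcal{A}_{n_{\mathsf Z}}}\otimes\mathsf{C}_{\mathcal{C}_1}\otimes\dots\otimes\mathsf{C}_{\mathcal{C}_{n_{\mathsf C}}}.$$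
   Context: Each party has a cardinality $\overline{A}=(A_1,\dots,A_X)$, a finite nonempty sequence of positive integers: inputs $x\in\{1,\dots,X\}$ and, for input $x$, outputs $a\in\{1,\dots,A_x\}$. Its space is $\mathcal{A}=\mathbb{R}^{\sum_x A_x}$ with standard basis $[a|x]$. An $n$-party behavior is an element of the tensor product of the party spaces, with coordinates $P(\text{outputs}|\text{inputs})$. A deterministic nonsignaling behavior is a product of single-party deterministic distributions: $P(a_1a_2\dots|x_1x_2\dots)=\prod_jP_j(a_j|x_j)$ where each $P_j$ is a conditional probability distribution with values in $\{0,1\}$. For a party with space $\mathcal{A}$ and cardinality $(A_1,\dots,A_X)$ define: $\vec Z_{\mathcal A}=\sum_{x}\sum_{a=1}^{A_x}\frac{1}{A_x}[a|x]$; $\vec C_{\mathcal A}^{\,i|x}=\frac{1}{A_x}([i|x]-[A_x|x])$ ($1\le x\le X$, $1\le i\le A_x-1$); $\vec S_{\mathcal A}^{\,k}=\sum_{a=1}^{A_k}\frac{X}{A_k}[a|k]-\vec Z_{\mathcal A}$ ($1\le k\le X-1$); $\mathsf{Z}_{\mathcal A}=\mathrm{span}(\vec Z_{\mathcal A})$, $\mathsf{C}_{\mathcal A}=\mathrm{span}\{\vec C_{\mathcal A}^{\,i|x}\}$, $\mathsf{S}_{\mathcal A}=\mathrm{span}\{\vec S_{\mathcal A}^{\,k}\}$, so that $\mathcal{A}=\mathsf{S}_{\mathcal A}\oplus\mathsf{C}_{\mathcal A}\oplus\mathsf{Z}_{\mathcal A}$. ($\mathsf{C}_{\mathcal A}\neq0$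 exactly when some $A_x>1$.) Components of an $n$-party vector refer to the decomposition of the $n$-fold tensor product into the $3^n$ subspaces obtained by expanding $\bigotimes(\mathsf{S}\oplus\mathsf{C}\oplus\mathsf{Z})$. *)

(* Defs.v *)
From HB Require Import structures.
From mathcomp Require Import all_boot all_order all_algebra.

Set Implicit Arguments.
Unset Strict Implicit.
Unset Printing Implicit Defensive.

Import Order.TTheory GRing.Theory Num.Theory.

Local Open Scope ring_scope.

Record cardinality := Cardinality {
  outs : seq nat;
  outs_nonempty : (0 < size outs)%N;
  outs_pos : all (leq 1) outs }.

(* Inputs and outputs are numbered from 0: the inputs are 0, ..., nin A - 1 and
   the outputs for input x are 0, ..., nout A x - 1. *)
Definition nin (A : cardinality) : nat := size (outs A).
Definition nout (A : cardinality) (x : nat) : nat := nth 0%N (outs A) x.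

(* [existT _ x a] is the output-input pair a|x. *)
Definition label (A : cardinality) : finType := {x : 'I_(nin A) & 'I_(nout A x)}.

Section Party.
Variables (R : realFieldType) (A : cardinality).

Definition party_space := {ffun label A -> R^o}.

(* The standard basis vector [a|x]; it is 0 when a|x is out of range. *)
Definition ket (a x : nat) : party_space :=
  [ffun u : label A =>
     ((val (tag u) == x) && (val (tagged u) == a))%:R : R^o].

Definition vecZ : party_space :=
  \sum_(x < nin A) \sum_(a < nout A x) ((nout A x)%:R^-1 : R) *: ket a x.

(* The last output for input x has number (nout A x).-1. *)
Definition vecC (i x : nat) : party_space :=
  ((nout A x)%:R^-1 : R) *: (ket i x - ket (nout A x).-1 x).

Definition vecS (k : nat) : party_space :=
  (\sum_(a < nout A k) ((nin A)%:R / (nout A k)%:R : R) *: ket a k) - vecZ.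

Definition subZ : {vspace party_space} := <[vecZ]>%VS.

Definition subC : {vspace party_space} :=
  <<[seq vecC (tagged w) (tag w)
      | w : {x : 'I_(nin A) & 'I_((nout A x).-1)}]>>%VS.

Definition subS : {vspace party_space} :=
  <<[seq vecS k | k : 'I_((nin A).-1)]>>%VS.

Definition is_conditional_distribution (p : party_space) : Prop :=
  (forall u, 0 <= p u) /\
  (forall x : 'I_(nin A), \sum_(a < nout A x) p (existT _ x a) = 1).

Definition is_deterministic_distribution (p : party_space) : Prop :=
  is_conditional_distribution p /\ (forall u, p u = 0 \/ p u = 1).

End Party.

Arguments subZ {R} A.
Arguments subC {R} A.
Arguments subS {R} A.

Inductive sector := SecS | SecC | SecZ.

Definition sector_code (s : sector) : option bool :=
  match s with SecS => None | SecC => Some false | SecZ => Some true end.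
Definition sector_decode (o : option bool) : sector :=
  match o with None => SecS | Some false => SecC | Some true => SecZ end.
Lemma sector_codeK : cancel sector_code sector_decode. Proof. by case. Qed.
HB.instance Definition _ := Countable.copy sector (can_type sector_codeK).
HB.instance Definition _ : isFinite sector := CanIsFinite sector_codeK.

Definition subsector (R : realFieldType) (A : cardinality) (s : sector) :
    {vspace party_space R A} :=
  match s with SecS => subS A | SecC => subC A | SecZ => subZ A end.

Section Parties.
Variables (R : realFieldType) (n : nat) (A : 'I_n -> cardinality).

Definition labels : finType := {dffun forall j : 'I_n, label (A j)}.

(* The tensor product of the party spaces, in coordinates on the basis of
   tensor products of standard basis vectors. *)
Definition nspace := {ffun labels -> R^o}.

Definition tensor (v : forall j, party_space R (A j)) : nspace :=
  [ffun u : labels => (\prod_(j < n) v j (u j) : R) : R^o].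

(* Spanned by the tensor products of bases, hence by all tensors of vectors of
   the V j, which it contains by [mem_tensorv] below. *)
Definition tensorv (V : forall j, {vspace party_space R (A j)}) : {vspace nspace} :=
  <<[seq tensor (fun j => (vbasis (V j))`_(f j))
      | f : {dffun forall j : 'I_n, 'I_(\dim (V j))}]>>%VS.

Definition sector_space (t : {ffun 'I_n -> sector}) : {vspace nspace} :=
  tensorv (fun j => subsector R (A j) (t j)).

(* [sumv_pi] is the projection onto the summand of index t along the others,
   because the sum of the sector spaces is direct and equal to the full space:
   see [sector_space_direct] and [sector_space_full] below. *)
Definition component (t : {ffun 'I_n -> sector}) (P : nspace) : nspace :=
  sumv_pi (\sum_(s : {ffun 'I_n -> sector}) sector_space s)%VS t P.

Definition is_deterministic_behavior (P : nspace) : Prop :=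
  exists2 p : forall j, party_space R (A j),
    (forall j, is_deterministic_distribution (p j)) & P = tensor p.

End Parties.

Lemma bigA_distr_dffun (R : comNzSemiRingType) (I : finType) (J : I -> finType)
    (F : forall i, J i -> R) :
  \prod_i \sum_(j : J i) F i j
  = \sum_(f : {dffun forall i, J i}) \prod_i F i (f i).
Proof.
pose G i : {ffun J i -> R} := [ffun j => F i j].
transitivity (\prod_i \sum_(u in tagged_with J i) untag 0 (G i) u).
  apply: eq_bigr => i _; rewrite -(big_tag (fun i => G i : J i -> R)).
  by apply: eq_bigr => j _; rewrite ffunE.
rewrite bigA_distr_big_dep -big_fprod (reindex (@fprod_of_dffun I J)) /=; last first.
  exact/onW_bij/fprod_of_dffun_bij.
by apply: eq_bigr => f _; apply: eq_bigr => i _; rewrite ffunE fprodE.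
Qed.

Section TensorFacts.
Variables (R : realFieldType) (n : nat) (A : 'I_n -> cardinality).

Lemma tensor_sum (J : 'I_n -> finType) (F : forall j, J j -> party_space R (A j)) :
  tensor (fun j => \sum_(i : J j) F j i)
  = \sum_(f : {dffun forall j, J j}) tensor (fun j => F j (f j)).
Proof.
apply/ffunP => u; rewrite !ffunE sum_ffunE.
under eq_bigr do rewrite sum_ffunE.
rewrite (bigA_distr_dffun (fun j (i : J j) => F j i (u j) : R)).
by apply: eq_bigr => f _; rewrite !ffunE.
Qed.

Lemma tensorZ (c : 'I_n -> R) (v : forall j, party_space R (A j)) :
  tensor (fun j => c j *: v j) = (\prod_j c j) *: tensor v.
Proof.
apply/ffunP => u; rewrite !ffunE -[RHS]big_split; apply: eq_bigr => j _.
by rewrite ffunE.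
Qed.

Lemma eq_tensor (v w : forall j, party_space R (A j)) :
  (forall j, v j = w j) -> tensor v = tensor w.
Proof.
by move=> e; apply/ffunP => u; rewrite !ffunE; apply: eq_bigr => j _; rewrite e.
Qed.

Lemma mem_tensorv (V : forall j, {vspace party_space R (A j)})
    (v : forall j, party_space R (A j)) :
  (forall j, v j \in V j) -> tensor v \in tensorv V.
Proof.
move=> vV.
rewrite (eq_tensor (fun j => coord_vbasis (vV j))) tensor_sum.
apply: memv_suml => f _; rewrite tensorZ; apply/memvZ/memv_span.
by apply: (image_f (fun f : {dffun forall j, 'I_(\dim (V j))} =>
  tensor (fun j => (vbasis (V j))`_(f j)))).
Qed.

Lemma dim_tensorv_leq (V : forall j, {vspace party_space R (A j)}) :
  (\dim (tensorv V) <= \prod_j \dim (V j))%N.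
Proof.
apply: leq_trans (dim_span _) _; rewrite size_image card_dep_ffun foldrE big_image /=.
by under eq_bigr do rewrite card_ord.
Qed.
End TensorFacts.

Section PartyFacts.
Variables (R : realFieldType) (A : cardinality).
Notation Zv := (vecZ R A).
Notation Cv := (vecC R A).
Notation Sv := (vecS R A).
Notation party_sum := (subS A + subC A + subZ A : {vspace party_space R A})%VS.

Lemma nout_gt0 (x : nat) : (x < nin A)%N -> (0 < nout A x)%N.
Proof. by move=> ltx; have /(all_nthP 0%N)/(_ x ltx) := outs_pos A. Qed.

Lemma big_sector (T : Type) (idx : T) (op : Monoid.com_law idx)
    (F : sector -> T) :
  \big[op/idx]_(s : sector) F s = op (F SecS) (op (F SecC) (F SecZ)).
Proof.
have e : perm_eq (index_enum sector) [:: SecS; SecC; SecZ].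
  by apply: uniq_perm; rewrite ?index_enum_uniq // => -[]; rewrite mem_index_enum.
by rewrite (perm_big _ e) /= !big_cons big_nil Monoid.mulm1.
Qed.

Let block (x : nat) : party_space R A :=
  \sum_(a < nout A x) ((nout A x)%:R^-1 : R) *: ket R A a x.

Lemma nz_nat (m : nat) : (0 < m)%N -> (m%:R : R) != 0.
Proof. by move=> m0; rewrite pnatr_eq0 -lt0n. Qed.

Lemma block_mem_lt (k : 'I_((nin A).-1)) : block k \in party_sum.
Proof.
have X0 : (nin A)%:R != 0 :> R by apply/nz_nat/outs_nonempty.
have -> : block k = ((nin A)%:R^-1 : R) *: (Sv k + Zv).
  rewrite /vecS subrK scaler_sumr; apply: eq_bigr => a _.
  by rewrite scalerA mulKf.
apply/memvZ/memv_add; last exact: memv_line.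
by apply/(subvP (addvSl _ _))/memv_span/(image_f (fun k : 'I__ => Sv k)).
Qed.

Lemma block_mem (x : nat) : (x < nin A)%N -> block x \in party_sum.
Proof.
have := outs_nonempty A; rewrite -/(nin A).
case EX : (nin A) => [//|m] _; rewrite ltnS leq_eqVlt => /orP[/eqP ->|ltx].
  have -> : block m = Zv - \sum_(k < m) block k.
    have -> : Zv = \sum_(x < nin A) block x by [].
    by rewrite EX big_ord_recr /= addrAC subrr add0r.
  apply: memvB; first exact/(subvP (addvSr _ _))/memv_line.
  apply: memv_suml => k _; have ltk : (k < (nin A).-1)%N by rewrite EX.
  exact: (block_mem_lt (Ordinal ltk)).
have ltx' : (x < (nin A).-1)%N by rewrite EX.
exact: (block_mem_lt (Ordinal ltx')).
Qed.

Lemma vecC_mem (x i : nat) :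
  (x < nin A)%N -> (i < nout A x)%N -> Cv i x \in party_sum.
Proof.
move=> ltx lti; have [ltiN|geiN] := ltnP i (nout A x).-1; last first.
  have -> : i = (nout A x).-1.
    by apply/eqP; rewrite eqn_leq geiN -ltnS prednK ?nout_gt0 ?lti.
  by rewrite /vecC subrr scaler0 mem0v.
apply/(subvP (addvSl _ _))/(subvP (addvSr _ _))/memv_span.
exact: (image_f (fun w : {x : 'I_(nin A) & 'I_((nout A x).-1)} =>
  Cv (tagged w) (tag w))
  (x := existT (fun x : 'I_(nin A) => 'I_((nout A x).-1)) (Ordinal ltx) (Ordinal ltiN))).
Qed.

Lemma ket_mem (x i : nat) :
  (x < nin A)%N -> (i < nout A x)%N -> ket R A i x \in party_sum.
Proof.
move=> ltx lti; have N0 := nz_nat (nout_gt0 ltx).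
have Elast : ket R A (nout A x).-1 x = block x - \sum_(a < nout A x) Cv a x.
  rewrite /block -sumrB; under eq_bigr do rewrite /vecC -scalerBr subKr.
  by rewrite sumr_const card_ord -scaler_nat scalerA divff // scale1r.
have Hlast : ket R A (nout A x).-1 x \in party_sum.
  rewrite Elast; apply: memvB; first exact: block_mem.
  by apply: memv_suml => a _; apply: vecC_mem.
have -> : ket R A i x = ((nout A x)%:R : R) *: Cv i x + ket R A (nout A x).-1 x.
  by rewrite /vecC scalerA divff // scale1r subrK.
by apply: memvD => //; apply/memvZ/vecC_mem.
Qed.

Lemma subsector_full :
  (\sum_(s : sector) subsector R A s = fullv)%VS.
Proof.
rewrite big_sector /= addvA; apply/vspaceP => v; rewrite memvf.
have -> : v = \sum_(u : label A) v u *: ket R A (tagged u) (tag u).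
  apply/ffunP => u; rewrite sum_ffunE (bigD1 u) //= !ffunE !eqxx big1 => [|w ne].
    by rewrite addr0 [_ *: _]mulr1.
  rewrite !ffunE; case: andP => [[/eqP e1 /eqP e2]|]; last by rewrite scaler0.
  case/eqP: ne; case: u w e1 e2 => [x a] [y b] /= /val_inj e1.
  by case: y / e1 b => b /val_inj ->.
apply: memv_suml => u _; apply/memvZ/ket_mem; exact: ltn_ord.
Qed.

Lemma dim_space : \dim {:party_space R A} = #|label A|.
Proof. by rewrite dimvf /dim /= muln1. Qed.

Lemma dim_subsector_leq :
  (\sum_(s : sector) \dim (subsector R A s) <= #|label A|)%N.
Proof.
rewrite big_sector /= addnA.
have dS : (\dim (subS A : {vspace party_space R A}) <= (nin A).-1)%N.
  by apply: leq_trans (dim_span _) _; rewrite size_image card_ord.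
have dZ : (\dim (subZ A : {vspace party_space R A}) <= 1)%N.
  by rewrite dim_vline; case: (_ != _).
have dC : (\dim (subC A : {vspace party_space R A}) <= \sum_(x < nin A) (nout A x).-1)%N.
  apply: leq_trans (dim_span _) _; rewrite size_image card_tagged sumnE.
  by rewrite big_map big_enum; under eq_bigr do rewrite card_ord.
apply: leq_trans (leq_add (leq_add dS dC) dZ) _.
rewrite addnAC addn1 prednK ?outs_nonempty // card_tagged sumnE big_map big_enum /=.
under [leqRHS]eq_bigr => x _ do
  rewrite card_ord -(prednK (nout_gt0 (ltn_ord x))) -add1n.
by rewrite big_split /= sum1_card card_ord.
Qed.
End PartyFacts.

Section SectorFacts.
Variables (R : realFieldType) (n : nat) (A : 'I_n -> cardinality).

Lemma dim_nspace : \dim {:nspace R A} = (\prod_j #|label (A j)|)%N.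
Proof.
by rewrite dimvf /dim /= muln1 card_dep_ffun foldrE big_image.
Qed.

Lemma sector_space_full :
  (\sum_(t : {ffun 'I_n -> sector}) sector_space R A t = fullv)%VS.
Proof.
apply/vspaceP => P; rewrite memvf.
pose delta j (a : label (A j)) : party_space R (A j) := [ffun b => (b == a)%:R : R^o].
have -> : P = \sum_(u : labels A) P u *: tensor (fun j => delta j (u j)).
  apply/ffunP => u; rewrite sum_ffunE (bigD1 u) //= !ffunE !big1 => [|w ne|j _].
  - by rewrite addr0 [_ *: _]mulr1.
  - rewrite !ffunE; have [j nej] : exists j, u j != w j.
      apply/existsP; apply: contraR ne => /existsPn h; apply/eqP/ffunP => j.
      by have := h j; rewrite negbK => /eqP.
    by rewrite (bigD1 j) //= ffunE (negPf nej) mul0r scaler0.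
  - by rewrite ffunE eqxx.
apply: memv_suml => u _; apply: memvZ.
have dec j : exists w : {ffun sector -> party_space R (A j)},
    (forall s, w s \in subsector R (A j) s) /\ delta j (u j) = \sum_s w s.
  have : delta j (u j) \in (\sum_(s : sector) subsector R (A j) s)%VS.
    by rewrite subsector_full memvf.
  case/memv_sumP => w wP ->; exists [ffun s => w s]; split=> [s|].
    by rewrite ffunE; apply: wP.
  by apply: eq_bigr => s _; rewrite ffunE.
have {}dec j : {w : {ffun sector -> party_space R (A j)} |
    [forall s, w s \in subsector R (A j) s] && (delta j (u j) == \sum_s w s)}.
  by apply: sigW; have [w [h1 /eqP h2]] := dec j; exists w; rewrite h2 andbT; apply/forallP.
have -> : tensor (fun j => delta j (u j)) = tensor (fun j => \sum_s sval (dec j) s).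
  by apply: eq_tensor => j; case: (dec j) => w /= /andP[_ /eqP].
rewrite (tensor_sum (fun j (s : sector) => sval (dec j) s)).
apply: memv_sumr => t _; apply: mem_tensorv => j.
by case: (dec j) => w /= /andP[/forallP].
Qed.

Lemma sector_space_direct :
  directv (\sum_(t : {ffun 'I_n -> sector}) sector_space R A t).
Proof.
rewrite directvEgeq /= sector_space_full dim_nspace.
apply: (@leq_trans (\sum_(t : {ffun 'I_n -> sector})
    \prod_j \dim (subsector R (A j) (t j)))).
  by apply: leq_sum => t _; apply: dim_tensorv_leq.
rewrite -(bigA_distr_bigA (fun j s => \dim (subsector R (A j) s))).
by apply: leq_prod => j _; apply: dim_subsector_leq.
Qed.
End SectorFacts.

(* Main.v *)
(* The component of a product behavior in a tensor product of sectors is the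
   tensor product of the single-party components, and such a tensor vanishes
   only if one of its factors does. The Z component of a single-party
   distribution is nonzero because S and C vectors have entries summing to 0,
   while the entries of a distribution sum to the number of inputs. If the C
   component vanished, the distribution would be uniform on the outputs of each
   input, hence not deterministic for an input with at least two outputs. *)
From HB Require Import structures.
Require Import Defs.
From mathcomp Require Import all_boot all_order all_algebra reals.

Set Implicit Arguments.
Unset Strict Implicit.
Unset Printing Implicit Defensive.

Import Order.TTheory GRing.Theory Num.Theory.

Local Open Scope ring_scope.

Lemma span_linear0 (K : fieldType) (U W : vectType K) (f : {linear U -> W})
    (X : seq U) (u : U) :
  {in X, forall x, f x = 0} -> u \in <<X>>%VS -> f u = 0.
Proof.
move=> fX0 uX; apply/eqP; rewrite -(lfunE f) -memv_ker.
apply: subvP u uX; apply/span_subvP => x xX.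
by rewrite memv_ker lfunE /= fX0.
Qed.

(** * Linear forms that detect single-party components *)

Section Party.
Variables (R : realFieldType) (A : cardinality).
Implicit Types (u : label A) (v p : party_space R A).

Definition total v : R^o := \sum_u v u.

Fact total_linear : linear total.
Proof.
move=> c v w; rewrite /total scaler_sumr -big_split; apply: eq_bigr => u _.
by rewrite !ffunE.
Qed.
HB.instance Definition _ :=
  GRing.isLinear.Build R (party_space R A) R^o _ total total_linear.

(** Phrased as a linear form so that equality of two entries can be checked on spanning vectors with
    [span_linear0]. *)
Definition output_gap u u' v : R^o := v u - v u'.

Fact output_gap_linear u u' : linear (output_gap u u').
Proof. by move=> c v w; rewrite /output_gap !ffunE scalerBr opprD addrACA. Qed.
HB.instance Definition _ u u' :=
  GRing.isLinear.Build R (party_space R A) R^o _ _ (output_gap_linear u u').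

Lemma total_ket (a x : nat) :
  (x < nin A)%N -> (a < nout A x)%N -> total (ket R A a x) = 1.
Proof.
move=> ltx lta; pose u0 : label A :=
  existT (fun x : 'I_(nin A) => 'I_(nout A x)) (Ordinal ltx) (Ordinal lta).
rewrite /total (bigD1 u0) //= ffunE !eqxx big1 ?addr0 // => -[y b] neu.
rewrite ffunE /=; case: andP => // -[/eqP ey /eqP eb].
case/eqP: neu; move: b eb; rewrite /u0.
(* The output [b] has been generalized because its type depends on [y]. *)
have -> : y = Ordinal ltx by apply: val_inj.
by move=> b eb; congr existT; apply: val_inj.
Qed.

(** With [c] equal to 1 this is the share of one input in [vecZ]; with [c] equal to [nin A] it is
    the first term of [vecS]. *)
Lemma total_uniform (c : R) (x : nat) : (x < nin A)%N ->
  total (\sum_(a < nout A x) (c / (nout A x)%:R) *: ket R A a x) = c.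
Proof.
move=> ltx; rewrite linear_sum (eq_bigr (fun=> c / (nout A x)%:R)) => [|a _].
  by rewrite sumr_const card_ord -[LHS]mulr_natr mulfVK //; exact/nz_nat/nout_gt0.
by rewrite linearZ /= total_ket // [_ *: _]mulr1.
Qed.

Lemma total_vecZ : total (vecZ R A) = (nin A)%:R.
Proof.
rewrite /vecZ linear_sum -[nin A in RHS]card_ord -sumr_const.
apply: eq_bigr => x _; rewrite -[RHS](total_uniform 1 (ltn_ord x)).
by congr total; apply: eq_bigr => a _; rewrite mul1r.
Qed.

(** Both terms of each spanning vector [vecS k] total [nin A]. *)
Lemma total_subS v : v \in subS A -> total v = 0.
Proof.
apply: (span_linear0 (f := total)) => _ /imageP[k _ ->].
rewrite /vecS linearB /= total_vecZ total_uniform ?subrr //.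
exact: leq_trans (ltn_ord k) (leq_pred _).
Qed.

Lemma total_subC v : v \in subC A -> total v = 0.
Proof.
apply: (span_linear0 (f := total)) => _ /imageP[[x i] _ ->] /=.
rewrite /vecC linearZ linearB /= !total_ket ?subrr ?scaler0 //.
- by rewrite prednK ?nout_gt0.
- exact: leq_trans (ltn_ord i) (leq_pred _).
Qed.

Lemma sum_ketE (c : R) (x : nat) u :
  (\sum_(a < nout A x) c *: ket R A a x) u = c *+ (val (tag u) == x).
Proof.
rewrite sum_ffunE; case: (eqVneq (val (tag u)) x) => [<-|ne].
  rewrite (bigD1 (tagged u)) //= !ffunE !eqxx big1 => [|a ne].
    by rewrite addr0 [_ *: _]mulr1.
  by rewrite !ffunE eqxx eq_sym (negPf ne : (val a == tagged u) = false) scaler0.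
by rewrite big1 // => a _; rewrite !ffunE (negPf ne) scaler0.
Qed.

Lemma vecZE u : vecZ R A u = (nout A (tag u))%:R^-1.
Proof.
rewrite sum_ffunE (bigD1 (tag u)) //= sum_ketE eqxx big1 ?addr0 // => x ne.
by rewrite sum_ketE eq_sym (negPf ne : (val x == tag u) = false).
Qed.

Lemma subZ_output_constant v u u' : v \in subZ A -> tag u = tag u' -> v u = v u'.
Proof. by move=> /vlineP[c ->] e; rewrite !ffunE !vecZE e. Qed.

(** Each [vecS k] combines vectors uniform on the outputs of an input, so its entry at [u] depends
    only on [tag u]. *)
Lemma subS_output_constant v u u' : v \in subS A -> tag u = tag u' -> v u = v u'.
Proof.
move=> vS e; apply/eqP; rewrite -subr_eq0; apply/eqP.
apply: (span_linear0 (f := output_gap u u')) vS => _ /imageP[k _ ->].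
rewrite /= /output_gap /vecS.
by rewrite [X in X - _]ffunE [X in _ - X]ffunE !sum_ketE !ffunE !vecZE e subrr.
Qed.

Lemma total_distribution p :
  is_conditional_distribution p -> total p = (nin A)%:R.
Proof.
move=> [_ p1]; rewrite /total -[nin A]card_ord -sumr_const.
under [RHS]eq_bigr => x _ do rewrite -(p1 x).
rewrite (sig_big_dep xpredT (fun=> xpredT)
  (fun (x : 'I_(nin A)) (a : 'I_(nout A x)) => p (existT _ x a))).
by apply: eq_bigr => -[].
Qed.

(** With at most one output per input, the family spanning [subC A] has an empty index set. *)
Lemma subC_neq0 :
  (subC A : {vspace party_space R A}) <> 0%VS ->
  exists x : 'I_(nin A), (1 < nout A x)%N.
Proof.
move=> C0; apply/existsP; apply: contra_notT C0 => /existsPn le1.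
apply/eqP; rewrite -subv0; apply/span_subvP => _ /imageP[[x i] _ ->].
have := leq_ltn_trans (leq0n _) (ltn_ord i).
by rewrite ltn_predRL (negPf (le1 x)).
Qed.

(** A common value 0 or 1 would sum over the outputs to 0 or to [nout A x], and neither is 1. *)
Lemma deterministic_not_output_constant p (x : 'I_(nin A)) :
  is_deterministic_distribution p -> (1 < nout A x)%N ->
  ~ (forall a b : 'I_(nout A x), p (existT _ x a) = p (existT _ x b)).
Proof.
move=> [[_ /(_ x) p1] p01] gt1 pc.
pose a0 := Ordinal (ltnW gt1); move: p1.
rewrite (eq_bigr (fun _ => p (existT _ x a0))) => [|a _]; last exact: pc.
rewrite sumr_const card_ord; case: (p01 (existT _ x a0)) => ->.
  by rewrite mul0rn => /esym/eqP; rewrite oner_eq0.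
by move/eqP; rewrite (eqr_nat R _ 1) => /eqP e; move: (gt1); rewrite e.
Qed.

(** * Nonvanishing of the single-party Z and C components *)

Variables (p : party_space R A) (w : sector -> party_space R A).
Hypotheses (pw : p = \sum_s w s) (wsec : forall s, w s \in subsector R A s).

Lemma distribution_Z_neq0 : is_conditional_distribution p -> w SecZ != 0.
Proof.
move=> /total_distribution tp; apply/eqP => wZ.
move: tp; rewrite pw big_sector /= wZ addr0 linearD /=.
rewrite (total_subS (wsec SecS)) (total_subC (wsec SecC)) [_ + _]addr0.
by move/esym/eqP; rewrite (negPf (nz_nat _ (outs_nonempty A))).
Qed.

Lemma deterministic_C_neq0 :
  (subC A : {vspace party_space R A}) <> 0%VS ->
  is_deterministic_distribution p -> w SecC != 0.
Proof.
move=> /subC_neq0[x gt1] dp; apply/eqP => wC.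
apply: (deterministic_not_output_constant dp gt1) => a b.
rewrite pw big_sector /= wC add0r !ffunE; congr (_ + _).
  exact: subS_output_constant (wsec SecS) _.
exact: subZ_output_constant (wsec SecZ) _.
Qed.
End Party.

(** * Tensor products and their components *)

Section Parties.
Variables (R : realFieldType) (n : nat) (A : 'I_n -> cardinality).

(** Picking a nonzero entry in each factor gives a nonzero entry of the tensor. *)
Lemma tensor_neq0 (v : forall j, party_space R (A j)) :
  (forall j, v j != 0) -> tensor v != 0.
Proof.
move=> v0; have supp j : {u : label (A j) | v j u != 0}.
  apply: sigW; apply/existsP; apply: contraR (v0 j) => /existsPn z.
  by apply/eqP/ffunP => u; rewrite ffunE; apply/eqP; rewrite -[_ == _]negbK z.
apply/eqP => /ffunP/(_ [ffun j => sval (supp j)])/eqP; apply/negP.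
rewrite !ffunE; apply/prodf_neq0 => j _; rewrite ffunE.
exact: svalP (supp j).
Qed.

(** The components of the sum and the vectors [v s] are two decompositions of it along a direct sum,
    hence equal. *)
Lemma component_sum (v : {ffun 'I_n -> sector} -> nspace R A)
    (t : {ffun 'I_n -> sector}) :
  (forall s, v s \in sector_space R A s) -> component t (\sum_s v s) = v t.
Proof.
move=> vS; set P := \sum_s v s.
have /directv_sum_unique/(_ (fun s => component s P) v) := sector_space_direct R A.
rewrite sumv_pi_sum ?sector_space_full ?memvf // eqxx.
by move=> /(_ (fun s _ => memv_sum_pi _ s P) (fun s _ => vS s))/esym/forallP/(_ t)/eqP.
Qed.

(** Multilinearity expands the tensor into one term per choice of sectors, each lying in the
    matching sector space. *)
Lemma component_tensor (w : forall j, sector -> party_space R (A j))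
    (t : {ffun 'I_n -> sector}) :
  (forall j s, w j s \in subsector R (A j) s) ->
  component t (tensor (fun j => \sum_s w j s)) = tensor (fun j => w j (t j)).
Proof.
move=> wS; rewrite tensor_sum.
rewrite (component_sum (v := fun s => tensor (fun j => w j (s j)))) // => s.
exact: mem_tensorv.
Qed.
End Parties.

Theorem proposition12 (R : realType) (n : nat) (A : 'I_n -> cardinality)
    (Zparties Cparties : {set 'I_n})
    (hcover : Zparties :|: Cparties = [set: 'I_n])
    (hdisj : [disjoint Zparties & Cparties])
    (hCparties : (0 < #|Cparties|)%N)
    (hC : forall j : 'I_n, j \in Cparties ->
            (subC (A j) : {vspace party_space R (A j)}) <> 0%VS)
    (P : nspace R A) (hP : is_deterministic_behavior P) :
  component [ffun j : 'I_n => if j \in Cparties then SecC else SecZ] P <> 0.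
Proof.
case: hP => p dp ->.
(* The sectors of a party span its whole space, so these projections of [p j] add up to [p j]. *)
pose w j s := sumv_pi (\sum_s subsector R (A j) s)%VS s (p j).
have wS j s : w j s \in subsector R (A j) s by apply: memv_sum_pi.
have pw j : p j = \sum_s w j s by rewrite sumv_pi_sum // subsector_full memvf.
rewrite (eq_tensor pw) component_tensor //; apply/eqP/tensor_neq0 => j.
rewrite ffunE; case: ifP => [jC|_].
  exact: deterministic_C_neq0 (pw j) (wS j) (hC _ jC) (dp j).
exact: distribution_Z_neq0 (pw j) (wS j) (dp j).1.
Qed.
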